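(* Let $k\ge2$ be an integer. For every graph $G$, an odd cycle $C$ of $G$ of length $\ell_k$ (the minimum possible length of a $k$-bad odd cycle) is $k$-bad if and only if $G[V(C)]$ contains a copy of $W_k$ as a (not necessarily induced) subgraph. Equivalently, a graph $G$ contains a $k$-bad odd cycle of length $\ell_k$ if and only if $G$ contains $W_k$ as a (not necessarily induced) subgraph.
   Context: All graphs are finite and simple. $\chi$ denotes chromatic number. An odd cycle $C$ of a graph $G$ (a cycle subgraph of odd length, not necessarily induced) is called $k$-bad if $\chi(G[V(C)])\ge k+1$, where $G[V(C)]$, the span of $C$, is the subgraph of $G$ induced by $V(C)$. For $k\ge2$, $\ell_k=k+1$ if $k$ is even and $\ell_k=k+2$ if $k$ is odd. The graph $W_k$ is defined as follows: if $k$ is even, $W_k=K_{k+1}$; if $k$ is odd, $W_k$ is obtained from a clique $Q\cong K_{k+1}$ by adding one new vertex $x$ adjacent to exactly two vertices of $Q$. *)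

(* Defs.v *)
From HB Require Import structures.
From mathcomp Require Import all_boot.

Set Implicit Arguments.
Unset Strict Implicit.
Unset Printing Implicit Defensive.

Record sgraph := SGraph {
  vertex :> finType;
  edge : rel vertex;
  edge_sym : symmetric edge;
  edge_irrefl : irreflexive edge }.

Arguments edge {s}.

Section Graphs.
Variable G : sgraph.

Definition proper_coloring (n : nat) (f : {ffun G -> 'I_n}) : bool :=
  [forall x, forall y, edge x y ==> (f x != f y)].

Definition colorable (n : nat) : bool :=
  [exists f : {ffun G -> 'I_n}, proper_coloring f].

Lemma colorable_exists : exists n, colorable n.
Proof.
exists #|G|; apply/existsP; exists [ffun x => enum_rank x].
apply/forallP=> x; apply/forallP=> y; apply/implyP=> exy.
rewrite !ffunE; apply/eqP=> /enum_rank_inj xy.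
by rewrite xy edge_irrefl in exy.
Qed.

Definition chromatic_number : nat := ex_minn colorable_exists.

Section Induced.
Variable A : {set G}.

Definition induced_edge : rel {x : G | x \in A} :=
  fun u v => edge (val u) (val v).

Lemma induced_edge_sym : symmetric induced_edge.
Proof. by move=> u v; apply: edge_sym. Qed.

Lemma induced_edge_irrefl : irreflexive induced_edge.
Proof. by move=> u; apply: edge_irrefl. Qed.

Definition induced : sgraph := SGraph induced_edge_sym induced_edge_irrefl.
End Induced.

(* A cycle subgraph is given by the sequence of its vertices in cyclic order;
   [size c] is then its length.  [ucycleb] alone also accepts sequences of
   length 0 and 2. *)
Definition odd_cycle (c : seq G) : bool :=
  [&& ucycleb edge c, 2 < size c & odd (size c)].

Definition span (c : seq G) : sgraph := induced [set x in c].

Section AddVertex.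
Variable A : {set G}.

(* The new vertex is [None]; its neighbourhood is [A]. *)
Definition add_vertex_edge : rel (option G) :=
  fun u v => match u, v with
             | Some x, Some y => edge x y
             | Some x, None => x \in A
             | None, Some y => y \in A
             | None, None => false
             end.

Lemma add_vertex_edge_sym : symmetric add_vertex_edge.
Proof. by case=> [x|] [y|] //=; apply: edge_sym. Qed.

Lemma add_vertex_edge_irrefl : irreflexive add_vertex_edge.
Proof. by case=> [x|] //=; apply: edge_irrefl. Qed.

Definition add_vertex : sgraph :=
  SGraph add_vertex_edge_sym add_vertex_edge_irrefl.
End AddVertex.

End Graphs.

Definition k_bad (k : nat) (G : sgraph) (c : seq G) : bool :=
  k.+1 <= chromatic_number (span c).

Definition contains (G H : sgraph) : Prop :=
  exists f : H -> G, injective f /\ forall x y, edge x y -> edge (f x) (f y).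

Section Complete.
Variable n : nat.

Definition complete_edge : rel 'I_n := fun i j => i != j.

Lemma complete_edge_sym : symmetric complete_edge.
Proof. by move=> i j; rewrite /complete_edge eq_sym. Qed.

Lemma complete_edge_irrefl : irreflexive complete_edge.
Proof. by move=> i; rewrite /complete_edge eqxx. Qed.

Definition complete : sgraph := SGraph complete_edge_sym complete_edge_irrefl.
End Complete.

Definition ell (k : nat) : nat := if odd k then k.+2 else k.+1.

Definition W (k : nat) : sgraph :=
  if odd k
  then @add_vertex (complete k.+1) [set i : 'I_k.+1 | i < 2]
  else complete k.+1.

(* Main.v *)
Require Import Defs.
From HB Require Import structures.
From mathcomp Require Import all_boot.

(** A [k]-bad odd cycle spans a graph on as many vertices as its length that
    is not [k]-colourable.  A graph on [n] vertices is [n]-colourable, so the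
    length is at least [k + 1], and by parity at least [ell k].

    At length [ell k] there is almost no room for saving colours.
    - For [k] even the span has [k + 1] vertices.  Giving the two ends of a
      non-edge the same colour saves one colour, so there is no non-edge
      ([uncolorable_complete]).
    - For [k] odd the span has [k + 2] vertices.  Two disjoint non-edges, or an
      independent triple, would save two colours ([merge_two_colorable]).  So
      the non-edges pairwise meet and form no triangle, hence all pass through
      one vertex [v] ([uncolorable_star]).  The other [k + 1] vertices form a
      clique, and the two neighbours of [v] along the cycle make [v] the extra
      vertex of [W k] ([two_neighbors]).

    Conversely [W k] contains a clique on [k + 1] vertices, so no graph
    containing it is [k]-colourable ([contains_W_uncolorable]).  Moreover [W k]
    has a Hamiltonian cycle, of length [ell k] ([W_hamiltonian]); its image
    under an embedding of [W k] in [G] is an odd cycle whose span contains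
    [W k], and it is therefore [k]-bad. *)

Set Implicit Arguments.
Unset Strict Implicit.
Unset Printing Implicit Defensive.

(** * Colourings *)

Lemma colorableP (G : sgraph) n :
  reflect (exists f : G -> 'I_n, forall x y, edge x y -> f x != f y)
          (colorable G n).
Proof.
apply: (iffP existsP) => [[f /forallP fP]|[f fP]].
  by exists f => x y exy; have /forallP/(_ y)/implyP := fP x; apply.
exists (finfun f); apply/forallP=> x; apply/forallP=> y; apply/implyP=> exy.
by rewrite !ffunE fP.
Qed.

Lemma colorable_leq (G : sgraph) m n :
  m <= n -> colorable G m -> colorable G n.
Proof.
move=> le_mn /colorableP[f fP]; apply/colorableP.
exists (fun x => widen_ord le_mn (f x)) => x y /fP.
by apply: contraNneq => /(congr1 val) /= /val_inj ->.
Qed.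

(** [chromatic_number] is a minimum, so only the monotonicity of colourability
    in the number of colours is at stake. *)
Lemma k_badE (k : nat) (G : sgraph) (c : seq G) :
  k_bad k c = ~~ colorable (span c) k.
Proof.
rewrite /k_bad /chromatic_number; case: ex_minnP => m colm min_m.
by rewrite ltnNge; congr (~~ _); apply/idP/idP => [/colorable_leq|/min_m//]; apply.
Qed.

(** Using vertices as colours makes identification of vertices a colouring;
    only the number of vertices that survive matters. *)
Lemma colorable_card_codom (G : sgraph) (g : G -> G) (A : {set G}) n :
    (forall x, g x \in A) -> #|A| <= n ->
    (forall x y, edge x y -> g x != g y) -> colorable G n.
Proof.
move=> gA leAn gP; apply: (colorable_leq leAn); apply/colorableP.
exists (fun x => enum_rank_in (gA x) (g x)) => x y /gP.
apply: contraNneq => /(congr1 enum_val).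
by rewrite !enum_rankK_in // => ->.
Qed.

Lemma colorable_card (G : sgraph) : colorable G #|G|.
Proof.
apply: (@colorable_card_codom G id setT) => // [|x y]; first by rewrite cardsT.
by apply: contraTneq => ->; rewrite edge_irrefl.
Qed.

(** The ends [a], [b] of a non-edge share a colour. *)
Lemma merge_one_colorable (G : sgraph) (a b : G) :
  a != b -> ~~ edge a b -> colorable G #|G|.-1.
Proof.
move=> ab nab.
apply: (@colorable_card_codom G (fun x => if x == b then a else x) [set~ b]).
- by move=> x; rewrite !inE; case: (eqVneq x b).
- by rewrite cardsC1.
move=> x y; case: (eqVneq x b) => [->|xb]; case: (eqVneq y b) => [->|yb].
- by rewrite edge_irrefl.
- by apply: contraTneq => <-; rewrite edge_sym.
- by apply: contraTneq => ->.
- by apply: contraTneq => ->; rewrite edge_irrefl.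
Qed.

(** Here [b] is coloured like [a] and [d] like [c].  Allowing [a = c] treats an
    independent triple and a pair of disjoint non-edges at once. *)
Lemma merge_two_colorable (G : sgraph) (a b c d : G) :
    b != d -> a \notin [set b; d] -> c \notin [set b; d] ->
    ~~ edge a b -> ~~ edge c d -> (a = c -> ~~ edge b d) ->
  colorable G #|G|.-2.
Proof.
move=> bd; rewrite !inE !negb_or => /andP[ab ad] /andP[cb cd] nab ncd nbd.
apply: (@colorable_card_codom G
  (fun x => if x == b then a else if x == d then c else x) (~: [set b; d])).
- move=> x; rewrite !inE negb_or; case: (eqVneq x b) => [_|xb].
    by rewrite ab ad.
  by case: (eqVneq x d) => [_|xd]; rewrite ?cb ?xb ?cd ?xd.
- by rewrite cardsCs setCK cards2 bd subn2.
have loop x y : edge x y -> x != y.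
  by apply: contraTneq => ->; rewrite edge_irrefl.
move=> x y exy.
case: (eqVneq x b) exy => [->|xb]; case: (eqVneq y b) => [->|yb];
  rewrite ?edge_irrefl //.
- case: (eqVneq y d) => [->|yd].
    by apply: contraTneq => /nbd.
  by apply: contraTneq => <-; rewrite edge_sym.
- case: (eqVneq x d) => [->|xd].
    by rewrite edge_sym; apply: contraTneq => /esym/nbd.
  by apply: contraTneq => ->.
- case: (eqVneq x d) => [->|xd]; case: (eqVneq y d) => [->|yd];
    rewrite ?edge_irrefl //.
  + by apply: contraTneq => <-; rewrite edge_sym.
  + by apply: contraTneq => ->.
  + exact: loop.
Qed.

Lemma uncolorable_complete (G : sgraph) (x y : G) :
  ~~ colorable G #|G|.-1 -> x != y -> edge x y.
Proof.
by move=> ncol xy; apply: contraNT ncol; apply: merge_one_colorable.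
Qed.

(** Pairwise intersecting pairs that do not form a triangle share a point:
    if [a b] is a non-edge and some non-edge misses [a], it is of the form
    [b d]; a non-edge missing [b] then has to be [a d], which is excluded. *)
Lemma uncolorable_star (G : sgraph) :
    0 < #|G| -> ~~ colorable G #|G|.-2 ->
  exists v : G, forall x y, x != v -> y != v -> x != y -> edge x y.
Proof.
move=> /card_gt0P[v0 _] ncol.
pose nonedge (x y : G) := (x != y) && ~~ edge x y.
have nonedgeC x y : nonedge x y = nonedge y x.
  by rewrite /nonedge eq_sym edge_sym.
have no_triple a b d : nonedge a b -> nonedge a d -> nonedge b d -> False.
  move=> /andP[ab nab] /andP[ad nad] /andP[bd nbd]; apply: (negP ncol).
  by apply: (@merge_two_colorable G a b a d); rewrite // !inE negb_or ab.
have meet a b c d : nonedge a b -> nonedge c d ->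
    [|| c == a, c == b, d == a | d == b].
  move=> /andP[ab nab] /andP[cd ncd].
  apply: contraNT ncol; rewrite !negb_or => /and4P[ca cb da db].
  apply: (@merge_two_colorable G a b c d) => //.
  - by rewrite eq_sym.
  - by rewrite !inE negb_or ab eq_sym.
  - by rewrite !inE negb_or cb.
  - by move=> ac; rewrite ac eqxx in ca.
have centerP v : (exists x y, [/\ x != v, y != v & nonedge x y]) \/
    (forall x y, x != v -> y != v -> x != y -> edge x y).
  case: (boolP [exists x, exists y, [&& x != v, y != v & nonedge x y]]).
    by move=> /existsP[x /existsP[y /and3P[? ? ?]]]; left; exists x, y.
  move=> /existsPn none; right=> x y xv yv xy.
  have /existsPn/(_ y) := none x.
  by rewrite xv yv /nonedge xy /= negbK.
have [[a [b [_ _ nab]]]|] := centerP v0; last by exists v0.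
have [[c [d [ca da ncd]]]|] := centerP a; last by exists a.
have {c d ca da ncd} [d da nbd] : exists2 d, d != a & nonedge b d.
  have := meet _ _ _ _ nab ncd; rewrite (negPf ca) (negPf da) /=.
  by case/orP=> /eqP eb; [exists d|exists c]; rewrite // -eb // nonedgeC.
have [[x [y [xb yb nxy]]]|] := centerP b; last by exists b.
have nad : nonedge a d.
  have := meet _ _ _ _ nbd nxy; have := meet _ _ _ _ nab nxy.
  rewrite (negPf xb) (negPf yb) /= !orbF.
  case/orP=> /eqP e1; case/orP=> /eqP e2; subst.
  - by rewrite eqxx in da.
  - by [].
  - by rewrite nonedgeC.
  - by rewrite eqxx in da.
by have := no_triple a b d nab nad nbd.
Qed.

(** * Containment *)

Lemma contains_trans (G H K : sgraph) :
  contains G H -> contains H K -> contains G K.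
Proof.
move=> [f [finj fP]] [g [ginj gP]]; exists (f \o g).
by split; [apply: inj_comp | move=> x y /gP/fP].
Qed.

Lemma contains_colorable (G H : sgraph) n :
  contains G H -> colorable G n -> colorable H n.
Proof.
move=> [f [_ fP]] /colorableP[g gP]; apply/colorableP.
by exists (g \o f) => x y /fP/gP.
Qed.

Lemma contains_span (G : sgraph) (c : seq G) : contains G (span c).
Proof. by exists val; split; first exact: val_inj. Qed.

Lemma contains_span_codom (G H : sgraph) (f : H -> G) (c : seq G) :
    injective f -> (forall x y, edge x y -> edge (f x) (f y)) ->
    (forall x, f x \in c) -> contains (span c) H.
Proof.
move=> finj fP fc.
have fA x : f x \in [set z in c] by rewrite inE.
exists (fun x => Sub (f x) (fA x) : span c); split; last exact: fP.
by move=> x y /(congr1 val) /finj.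
Qed.

Lemma complete_uncolorable k : ~~ colorable (complete k.+1) k.
Proof.
apply/colorableP=> -[f fP].
have finj : injective f by move=> x y; apply: contra_eq; apply: fP.
by have := leq_card f finj; rewrite !card_ord ltnn.
Qed.

Lemma clique_nth (G : sgraph) (x0 : G) (s : seq G) n :
    uniq s -> size s = n ->
    {in s &, forall x y, x != y -> edge x y} ->
  injective (fun i : 'I_n => nth x0 s i) /\
  (forall i j : 'I_n, i != j -> edge (nth x0 s i) (nth x0 s j)).
Proof.
move=> us sz cl.
have inj_nth (i j : 'I_n) : nth x0 s i = nth x0 s j -> i = j.
  by move=> /eqP; rewrite nth_uniq ?sz // => /eqP/val_inj.
split=> // i j ij; apply: cl; rewrite ?mem_nth ?sz //.
by apply: contraNneq ij => /inj_nth ->.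
Qed.

(** * The graph [W k] *)

Lemma contains_W_complete k : contains (W k) (complete k.+1).
Proof.
rewrite /W; case: (odd k); last by exists id; split.
by exists Some; split=> // x y [].
Qed.

Lemma contains_W_uncolorable k (G : sgraph) :
  contains G (W k) -> ~~ colorable G k.
Proof.
move=> GW; apply: contra (complete_uncolorable k); apply: contains_colorable.
exact: contains_trans GW (contains_W_complete k).
Qed.

(** A path needs only consecutive terms to be adjacent, and in a clique that is
    for free. *)
Lemma uniq_path_complete n (x : 'I_n) (s : seq 'I_n) :
  uniq (x :: s) -> path (@edge (complete n)) x s.
Proof.
elim: s x => //= y s IHs x /andP[]; rewrite inE negb_or => /andP[xy _] us.
by rewrite IHs // andbT.
Qed.

Lemma ell_ge3 k : 2 <= k -> 2 < ell k.
Proof. by rewrite /ell; case: (odd k) => // /leqW. Qed.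

Lemma odd_ell k : odd (ell k).
Proof. by rewrite /ell; case: ifP => /= ->. Qed.

(** The cycle may visit a clique in any order.  In the odd case the extra vertex
    goes between its two neighbours [0] and [1], so the clique is traversed
    as [0, 2, ..., k, 1]. *)
Lemma W_hamiltonian k : 2 <= k ->
  exists c : seq (W k), [/\ ucycleb edge c, size c = ell k & forall x, x \in c].
Proof.
move=> k2; rewrite /W /ell; case: (odd k); last first.
  exists (enum 'I_k.+1); split; last by move=> x; rewrite mem_enum.
    rewrite /ucycleb enum_uniq andbT.
    (* Repeating the first vertex at the end breaks uniqueness, so the
       closing edge is treated apart. *)
    have: uniq (enum 'I_k.+1) by exact: enum_uniq.
    have: 1 < size (enum 'I_k.+1) by rewrite size_enum_ord ltnW.
    case: (enum _) => [|x s] // ss us.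
    rewrite /cycle rcons_path uniq_path_complete //=.
    case/lastP: s ss us => // s y _; rewrite last_rcons /= mem_rcons inE.
    by rewrite negb_or eq_sym => /andP[/andP[]].
  by rewrite size_enum_ord.
pose i0 : 'I_k.+1 := ord0; pose i1 : 'I_k.+1 := inord 1.
have i1E : i1 = 1 :> nat by rewrite inordK // ltnS ltnW.
have i01 : i0 != i1 by rewrite -val_eqE /= i1E.
pose t : seq 'I_k.+1 := i0 :: rcons (enum (~: [set i0; i1])) i1.
have ut : uniq t.
  rewrite /= mem_rcons rcons_uniq inE !mem_enum !inE !eqxx orbT /=.
  by rewrite enum_uniq orbF i01.
exists (None :: map some t); split.
- have umt : uniq (None :: map some t).
    rewrite cons_uniq map_inj_uniq ?ut ?andbT; last by move=> x y [].
    by apply/mapP=> -[].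
  rewrite /ucycleb umt andbT /= rcons_path map_rcons last_rcons /=.
  rewrite !inE i1E andbT /= -map_rcons.
  by rewrite path_map; exact: uniq_path_complete ut.
- rewrite /= size_map size_rcons -cardE cardsCs setCK cards2 i01 card_ord subn2.
  by rewrite /= prednK // ltnW.
case=> [x|] //; rewrite inE /= -[Some i0 :: _]/(map some t) mem_map.
  rewrite inE mem_rcons inE mem_enum !inE.
  by case: (x == i0); case: (x == i1).
by move=> y z [].
Qed.

(** * Spans of cycles of length [ell k] *)

Lemma card_span (G : sgraph) (c : seq G) : uniq c -> #|span c| = size c.
Proof. by move=> uc; rewrite card_sig cardsE; apply/card_uniqP. Qed.

(** Rotate the cycle so that it starts at [v]: the neighbours are its second and
    its last entry, which differ because the length is at least 3. *)
Lemma two_neighbors (G : sgraph) (c : seq G) (v : span c) :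
    ucycleb edge c -> 2 < size c ->
  exists p q : span c, [/\ p != q, edge v p & edge v q].
Proof.
move=> /andP[cc uc] c3.
have vc : val v \in c by have := valP v; rewrite inE.
have [i s rotE] := rot_to vc.
move: cc uc c3; rewrite -(rot_cycle i) -(rot_uniq i) -(size_rot i).
have sc x : x \in s -> x \in [set z in c].
  by move=> xs; rewrite inE -(mem_rot i) rotE inE xs orbT.
rewrite {}rotE; case: s sc => [|p s] // sc; case/lastP: s sc => [|s q] // sc.
rewrite /cycle rcons_path /= last_rcons => /andP[/andP[vp _] qv] us _.
have pc : p \in [set z in c] by rewrite sc ?mem_head.
have qc : q \in [set z in c] by rewrite sc // inE mem_rcons mem_head orbT.
exists (Sub p pc), (Sub q qc); split; last 2 first.
- exact: vp.
- by move: qv; rewrite edge_sym.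
rewrite -val_eqE /=; case/and3P: us => _ + _.
by rewrite mem_rcons inE negb_or => /andP[].
Qed.

Lemma contains_W_even k (G : sgraph) :
    ~~ odd k -> #|G| = k.+1 -> ~~ colorable G k -> contains G (W k).
Proof.
move=> ek cardG ncol; rewrite /W (negPf ek).
have [x0 _] : exists x0 : G, x0 \in G by apply/card_gt0P; rewrite cardG.
have [] := @clique_nth G x0 (enum G) k.+1 (enum_uniq _).
- by rewrite -cardE.
- by move=> x y _ _; apply: uncolorable_complete; rewrite cardG.
by move=> finj fP; exists (fun i : 'I_k.+1 => nth x0 (enum G) i).
Qed.

Lemma contains_W_odd k (G : sgraph) :
    odd k -> #|G| = k.+2 -> ~~ colorable G k ->
    (forall v : G, exists p q : G, [/\ p != q, edge v p & edge v q]) ->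
  contains G (W k).
Proof.
move=> ok cardG ncol deg2; rewrite /W ok.
have [||v vP] := @uncolorable_star G; rewrite ?cardG //.
have [p [q [pq evp evq]]] := deg2 v.
have vN x : edge v x -> x != v by apply: contraTneq => ->; rewrite edge_irrefl.
have pv := vN _ evp; have qv := vN _ evq.
(* The clique minus [v], listed with the neighbours of [v] in the positions
   [0] and [1] to which the extra vertex of [W k] is attached. *)
pose s := p :: q :: enum (~: [set v; p; q]).
have us : uniq s.
  by rewrite /= !inE !mem_enum !inE !eqxx !orbT (negPf pq) enum_uniq.
have vNs x : x \in s -> x != v.
  rewrite !inE => /or3P[/eqP->|/eqP->|] //.
  by rewrite mem_enum !inE !negb_or => /andP[/andP[]].
have sizes : size s = k.+1.
  rewrite /= -cardE cardsCs setCK cardG setUC cardsU1 cards2 !inE negb_or.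
  rewrite qv [q == p]eq_sym pq [v == p]eq_sym pv /=.
  by case: k ok {cardG ncol} => // k _; rewrite add1n !subSS subn0.
have [x y xs ys|finj fP] := @clique_nth G v s k.+1 us sizes.
  by apply: vP; apply: vNs.
have fN (i : 'I_k.+1) : nth v s i != v by apply: vNs; rewrite mem_nth ?sizes.
have ev (i : 'I_k.+1) : i < 2 -> edge v (nth v s i).
  by case: i => -[|[|i]].
exists (fun o : option 'I_k.+1 => if o is Some i then nth v s i else v).
split.
  move=> [i|] [j|] // => [/finj->//|/eqP|/esym/eqP]; by rewrite (negPf (fN _)).
move=> [i|] [j|] //=.
- exact: fP.
- by rewrite inE edge_sym; exact: ev.
- by rewrite inE; exact: ev.
Qed.

Lemma ell_le_k_bad k (G : sgraph) (c : seq G) :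
  odd_cycle c -> k_bad k c -> ell k <= size c.
Proof.
move=> /and3P[/andP[_ uc] _ oc]; rewrite k_badE => ncol.
have lt_kc : k < size c.
  rewrite ltnNge -(card_span uc); apply: contra ncol => le_ck.
  exact: colorable_leq le_ck (colorable_card _).
rewrite /ell; case: ifP => // ok.
by rewrite ltn_neqAle lt_kc andbT; apply: contraTneq oc => <-; rewrite /= ok.
Qed.

Lemma k_bad_contains_W k (G : sgraph) (c : seq G) :
  odd_cycle c -> size c = ell k -> k_bad k c <-> contains (span c) (W k).
Proof.
move=> /and3P[cc c3 _] sz; rewrite k_badE.
have cardc : #|span c| = ell k by rewrite card_span //; case/andP: cc.
split=> [ncol|]; last exact: contains_W_uncolorable.
move: cardc; rewrite /ell; case: ifP => [ok|/negbT ek] cardc.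
  by apply: contains_W_odd => // v; apply: two_neighbors.
exact: contains_W_even.
Qed.

Lemma exists_k_bad_contains_W k (G : sgraph) : 2 <= k ->
  (exists c : seq G, [/\ odd_cycle c, size c = ell k & k_bad k c])
  <-> contains G (W k).
Proof.
move=> k2; split=> [[c [oc sz /(k_bad_contains_W oc sz)]]|[f [finj fP]]].
  exact/contains_trans/contains_span.
have [c [/andP[cc uc] sz memc]] := W_hamiltonian k2.
have oc : odd_cycle (map f c).
  rewrite /odd_cycle /ucycleb size_map sz ell_ge3 // odd_ell !andbT.
  rewrite map_inj_uniq // uc andbT cycle_map.
  by apply: sub_cycle cc => x y /fP.
exists (map f c); split; rewrite ?size_map //.
apply/k_bad_contains_W; rewrite ?size_map //.
by apply: (contains_span_codom finj fP) => x; rewrite map_f.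
Qed.

Theorem theorem5p1 (k : nat) (hk : 2 <= k) :
  [/\ (* ell k is the minimum length of a k-bad odd cycle *)
      (exists (G : sgraph) (c : seq G),
          [/\ odd_cycle c, k_bad k c & size c = ell k])
      /\ (forall (G : sgraph) (c : seq G),
          odd_cycle c -> k_bad k c -> ell k <= size c),
      (forall (G : sgraph) (c : seq G),
          odd_cycle c -> size c = ell k ->
          (k_bad k c <-> contains (span c) (W k)))
    & (forall G : sgraph,
          (exists c : seq G, [/\ odd_cycle c, size c = ell k & k_bad k c])
          <-> contains G (W k))].
Proof.
split; last by move=> G; apply: exists_k_bad_contains_W.
  split; last exact: ell_le_k_bad.
  have [|c [oc sz bad]] := (exists_k_bad_contains_W (W k) hk).2.
    by exists id; split.
  by exists (W k), c.
exact: k_bad_contains_W.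
Qed.
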